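(* Let $X$ and $Y$ be non-trivial real Banach spaces, let $H$ be a closed subspace of $\mathcal{L}(X,Y)$ containing the finite rank operators, and let $\delta>0$. (1) Let $H$ be $\delta$-average rough. (a) If $X^\ast$ is non-rough, then $Y$ is $\delta$-average rough. (b) If $Y$ is non-rough, then $X^\ast$ is $\delta$-average rough. (2) Let $H$ be $\delta$-rough. (a) If $X^\ast$ is non-rough, then $Y$ is $\delta$-rough. (b) If $Y$ is non-rough, then $X^\ast$ is $\delta$-rough.
   Context: For Banach spaces $X,Y$, $\mathcal{L}(X,Y)$ is the Banach space of all bounded linear operators from $X$ to $Y$ with the operator norm, $X^\ast$ is the dual of $X$, and $S_X$ is the unit sphere of $X$. ''$H$ contains the finite rank operators'' means that $H$ contains all bounded finite rank operators from $X$ to $Y$; $H$ carries the operator norm. Let $Z$ be a Banach space and $\delta>0$. $Z$ is $\delta$-rough if, for every $z\in S_Z$, \[\limsup_{\|y\|\to 0}\frac{\|z+y\|+\|z-y\|-2}{\|y\|}\geq\delta.\] $Z$ is $\delta$-average rough if, whenever $n\in\mathbb{N}$ and $z_1,\dots,z_n\in S_Z$, \[\limsup_{\|y\|\to 0}\frac1n\sum_{i=1}^n\frac{\|z_i+y\|+\|z_i-y\|-2}{\|y\|}\geq\delta.\] (The limsups are over $y\in Z\setminus\{0\}$.) $Z$ is non-rough if there is no $\varepsilon>0$ such that $Z$ is $\varepsilon$-rough. *)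

(* Defs.v *)
From HB Require Import structures.
From mathcomp Require Import all_boot all_order all_algebra.
From mathcomp Require Import all_classical all_reals all_analysis.

Set Implicit Arguments.
Unset Strict Implicit.
Unset Printing Implicit Defensive.

Import Order.TTheory GRing.Theory Num.Theory.
Import numFieldNormedType.Exports.

Local Open Scope classical_set_scope.
Local Open Scope ring_scope.

Definition is_bounded_op (R : realType) (X Y : normedModType R) (f : X -> Y) :=
  exists M : R, forall x, `|f x| <= M * `|x|.

Definition bounded_linear (R : realType) (X Y : normedModType R) :
    {pred X -> Y} :=
  mem [set f : X -> Y | linear f /\ is_bounded_op f].

Section BoundedOperators.
Variables (R : realType) (X Y : normedModType R).

Lemma bounded_linearP (f : X -> Y) :
  reflect (linear f /\ is_bounded_op f) (f \in @bounded_linear R X Y).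
Proof. by apply: (iffP idP); rewrite inE. Qed.

Lemma bounded_linear_submod_closed : submod_closed (@bounded_linear R X Y).
Proof.
split.
  apply/bounded_linearP; split=> [a x y|]; first by rewrite scaler0 addr0.
  by exists 0 => x; rewrite normr0 mul0r.
move=> a f g /bounded_linearP[lf [M fM]] /bounded_linearP[lg [N gN]].
apply/bounded_linearP; split=> [b x y|].
  rewrite /= !fctE /= lf lg !scalerDr !scalerA (mulrC a b) -!addrA.
  by congr (_ + _); rewrite addrCA.
exists (`|a| * M + N) => x; rewrite (le_trans (ler_normD _ _))// mulrDl.
by rewrite lerD// normrZ -mulrA ler_wpM2l.
Qed.

HB.instance Definition _ :=
  GRing.isSubmodClosed.Build R (X -> Y) (@bounded_linear R X Y)
    bounded_linear_submod_closed.

Record bounded_op := BoundedOp {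
  bounded_op_fun :> X -> Y ;
  _ : bounded_op_fun \in @bounded_linear R X Y }.

HB.instance Definition _ := [isSub for bounded_op_fun].
HB.instance Definition _ := [Choice of bounded_op by <:].
HB.instance Definition _ := [SubChoice_isSubLmodule of bounded_op by <:].

Implicit Types f g : bounded_op.

(* a supremum of reals: nonempty and bounded above by op_norm_has_sup *)
Definition op_norm f : R := sup [set `|f x| | x in [set x : X | `|x| <= 1]].

Lemma bounded_op_linear f : linear f.
Proof. by have /bounded_linearP[] := valP f. Qed.

HB.instance Definition _ f :=
  GRing.isLinear.Build R X Y *:%R f (@bounded_op_linear f).

Lemma op_norm_has_sup f :
  has_sup [set `|f x| | x in [set x : X | `|x| <= 1]].
Proof.
split; first by exists `|f 0|, 0 => //=; rewrite normr0.
have /bounded_linearP[_ [M fM]] := valP f.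
exists `|M| => _ [x /= x1 <-]; rewrite (le_trans (fM x))//.
by rewrite (le_trans (ler_wpM2r _ (ler_norm M)))// ler_piMr.
Qed.

Lemma ler_op_norm1 f (x : X) : `|x| <= 1 -> `|f x| <= op_norm f.
Proof. by move=> x1; apply: (sup_upper_bound (op_norm_has_sup f)); exists x. Qed.

Lemma op_norm_ge0 f : 0 <= op_norm f.
Proof. by rewrite (le_trans _ (@ler_op_norm1 f 0 _))// normr0. Qed.

Lemma op_norm_le f (M : R) : (forall x : X, `|x| <= 1 -> `|f x| <= M) ->
  op_norm f <= M.
Proof.
move=> fM; apply: ge_sup; first exact: (op_norm_has_sup f).1.
by move=> _ [x x1 <-]; exact: fM.
Qed.

Lemma ler_op_normD f g : op_norm (f + g) <= op_norm f + op_norm g.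
Proof.
apply: op_norm_le => x x1.
by rewrite (le_trans (ler_normD _ _))// lerD// ler_op_norm1.
Qed.

Lemma ler_op_normZ (a : R) f : op_norm (a *: f) <= `|a| * op_norm f.
Proof.
by apply: op_norm_le => x x1; rewrite normrZ ler_wpM2l// ler_op_norm1.
Qed.

Lemma op_normZ (a : R) f : op_norm (a *: f) = `|a| * op_norm f.
Proof.
apply/eqP; rewrite eq_le ler_op_normZ/=.
have [->|a0] := eqVneq a 0; first by rewrite normr0 mul0r op_norm_ge0.
rewrite -ler_pdivlMl ?normr_gt0// -normfV.
by rewrite -{1}(scalerK a0 f) ler_op_normZ.
Qed.

Lemma op_norm0_eq0 f : op_norm f = 0 -> f = 0.
Proof.
move=> f0; apply/val_inj/funext => x /=.
have [->|x0] := eqVneq x 0; first exact: linear0.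
have : `|f (`|x|^-1 *: x)| <= 0.
  by rewrite -f0 ler_op_norm1// normrZ normfV normr_id mulVf// normr_eq0.
rewrite linearZ normr_le0 scaler_eq0 invr_eq0 normr_eq0 (negbTE x0)/=.
by move/eqP.
Qed.

HB.instance Definition _ :=
  Lmodule_isNormed.Build R bounded_op ler_op_normD op_normZ op_norm0_eq0.

(* the range is the span of a finite family *)
Definition finite_rank f := exists n (e : 'I_n -> Y),
  range f = [set \sum_(i < n) c i *: e i | c in [set: 'I_n -> R]].

End BoundedOperators.

Notation "''L' ( X , Y )" := (bounded_op X Y) (at level 8, format "''L' ( X ,  Y )").

Notation dual X := ('L(X, _^o)) (only parsing).

Section Subspaces.
Variables (R : realType) (V : normedModType R) (H : submodClosed V).

Record subspace_of := SubspaceOf {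
  subspace_val :> V ;
  _ : subspace_val \in H }.

HB.instance Definition _ := [isSub for subspace_val].
HB.instance Definition _ := [Choice of subspace_of by <:].
HB.instance Definition _ := [SubChoice_isSubLmodule of subspace_of by <:].

Definition subspace_norm (u : subspace_of) : R := `|subspace_val u|.

Lemma ler_subspace_normD u v :
  subspace_norm (u + v) <= subspace_norm u + subspace_norm v.
Proof. exact: ler_normD. Qed.

Lemma subspace_normZ (a : R) u : subspace_norm (a *: u) = `|a| * subspace_norm u.
Proof. exact: normrZ. Qed.

Lemma subspace_norm0_eq0 u : subspace_norm u = 0 -> u = 0.
Proof. by move/normr0_eq0 => u0; exact: val_inj. Qed.

HB.instance Definition _ := Lmodule_isNormed.Build R subspace_of
  ler_subspace_normD subspace_normZ subspace_norm0_eq0.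

End Subspaces.

(* Roughness involves only the norm, so completeness is not required here; the
   filter 0^' restricts the limit superior to nonzero y *)
Section Roughness.
Variables (R : realType) (Z : normedModType R).

Definition rough_quotient (z y : Z) : R :=
  (`|z + y| + `|z - y| - 2) / `|y|.

Definition rough (delta : R) := forall z : Z, `|z| = 1 ->
  (delta%:E <= limf_esup (fun y => (rough_quotient z y)%:E) (0%R : Z)^')%E.

Definition average_rough (delta : R) :=
  forall (n : nat) (z : 'I_n -> Z), (0 < n)%N -> (forall i, `|z i| = 1) ->
  (delta%:E <= limf_esup
     (fun y => (n%:R^-1 * \sum_(i < n) rough_quotient (z i) y)%:E) (0%R : Z)^')%E.

Definition non_rough := ~ exists2 e : R, 0 < e & rough e.

End Roughness.
Arguments rough {R} Z delta.
Arguments average_rough {R} Z delta.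
Arguments non_rough {R} Z.

(* Main.v *)
(* Let W be the non-rough space among X^* and Y, and Z the other one. A point w
   of S_W at which the norm is nearly smooth determines a slice of small diameter
   in a norming set of functionals: unit vectors x of X if W = X^*, unit
   functionals f on Y if W = Y. Fix an element of that slice; evaluating at it,
   T |-> T x0 or T |-> f0 \o T, is a linear contraction phi from H to Z. For z in
   S_Z and small T, a pair (x, f) nearly norming w (x) z + T must have its
   W-component in the slice, so that f (T x) is within e |T| of its value at
   phi T, whence |w (x) z + T| <= |z + phi T| + e |T|. The same phi serves all z and
   both signs of T, so roughness of H at the tensors w (x) z_i passes to Z. *)

Require Import Defs.
From HB Require Import structures.
From mathcomp Require Import all_boot all_order all_algebra.
From mathcomp Require Import all_classical all_reals all_analysis.
From mathcomp Require Import lra.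
Import Order.TTheory GRing.Theory Num.Theory.
Import numFieldNormedType.Exports.
Local Open Scope classical_set_scope.
Local Open Scope ring_scope.

(** * Hahn-Banach theorem for functionals dominated by a sublinear one *)

Definition sublinear {R : realType} {V : lmodType R} (p : V -> R) :=
  (forall x y, p (x + y) <= p x + p y) /\
  (forall t x, 0 <= t -> p (t *: x) <= t * p x).

Section HahnBanach.
Context {R : realType} {V : lmodType R}.
Implicit Types (p q : V -> R) (F : set (V -> R)).

Lemma sublinear0 {p} : sublinear p -> p 0 = 0.
Proof.
move=> [pD pZ]; apply/eqP; rewrite eq_le; apply/andP; split.
  by have := pZ 0 0 (lexx 0); rewrite scale0r mul0r.
by have := pD 0 0; rewrite addr0 -lerBlDr subrr.
Qed.

Lemma sublinear_geN {p} x : sublinear p -> - p (- x) <= p x.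
Proof.
move=> sp; have := sp.1 x (- x).
by rewrite subrr (sublinear0 sp) -lerBlDr sub0r.
Qed.

(** The closure conditions let the dominating member of [F] depend on the points, which fits both
    the family in [sublinear_shift] and chains in Zorn's lemma. Subadditivity comes from adding
    near-minimisers at [x] and [y]. *)
Lemma inf_sublinear F : F !=set0 ->
  (forall x, has_lbound [set q x | q in F]) ->
  (forall q1 q2 x y, F q1 -> F q2 ->
    exists2 q, F q & q (x + y) <= q1 x + q2 y) ->
  (forall q1 t x, F q1 -> 0 <= t -> exists2 q, F q & q (t *: x) <= t * q1 x) ->
  sublinear (fun x => inf [set q x | q in F]).
Proof.
move=> [q0 Fq0] lbF FD FZ.
have hasF x : has_inf [set q x | q in F] by split=> //; exists (q0 x), q0.
have infF q x : F q -> inf [set q x | q in F] <= q x.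
  by move=> Fq; apply: (ge_inf (lbF x)); exists q.
split=> [x y|t x t0].
  apply/ler_addgt0Pr => e e0.
  have e2 : 0 < e / 2 by rewrite divr_gt0.
  have [_ [q1 Fq1 <-] q1x] := inf_adherent e2 (hasF x).
  have [_ [q2 Fq2 <-] q2y] := inf_adherent e2 (hasF y).
  have [q Fq qxy] := FD _ _ x y Fq1 Fq2.
  by have := infF _ (x + y) Fq; lra.
have le_tq q : F q -> inf [set q (t *: x) | q in F] <= t * q x.
  move=> Fq; have [q' Fq' q'x] := FZ _ _ x Fq t0.
  exact: le_trans (infF _ _ Fq') q'x.
(* Dividing by [t] needs [t > 0]; at [t = 0] the single member [q0] already gives the bound 0. *)
move: t0; rewrite le_eqVlt => /orP[/eqP t0|t0].
  by have := le_tq _ Fq0; rewrite -t0 !mul0r.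
rewrite -ler_pdivrMl//; apply: lb_le_inf; first by exists (q0 x), q0.
by move=> _ [q Fq <-]; rewrite ler_pdivrMl//; exact: le_tq.
Qed.

Lemma sublinearZ {p} t x : sublinear p -> 0 <= t -> p (t *: x) = t * p x.
Proof.
move=> sp; rewrite le_eqVlt => /orP[/eqP <-|t0].
  by rewrite scale0r mul0r sublinear0.
apply/eqP; rewrite eq_le (sp.2 _ _ (ltW t0))/= -ler_pdivlMl//.
have := sp.2 t^-1 (t *: x); rewrite scalerA mulVf ?gt_eqF// scale1r.
by apply; rewrite invr_ge0 ltW.
Qed.

(* The minorant is [x |-> inf_(t >= 0) (p (x + t v) - t p v)]. *)
Lemma sublinear_shift p v : sublinear p -> exists q,
  [/\ sublinear q, forall x, q x <= p x & q (- v) <= - p v].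
Proof.
move=> sp; have [pD pZ] := sp.
pose F : set (V -> R) :=
  [set (fun x => p (x + t *: v) - t * p v) | t in [set t | 0 <= t]].
have lbF x : has_lbound [set q x | q in F].
  exists (- p (- x)) => _ [_ [t /= t0 <-] <-].
  have := pD (x + t *: v) (- x).
  by rewrite addrAC subrr add0r (sublinearZ _ _ sp)//; lra.
have infF t x : 0 <= t ->
    inf [set q x | q in F] <= p (x + t *: v) - t * p v.
  move=> t0; apply: (ge_inf (lbF x)).
  by exists (fun x => p (x + t *: v) - t * p v) => //; exists t.
exists (fun x => inf [set q x | q in F]); split.
- apply: inf_sublinear => //.
  + by exists (fun x => p (x + 0 *: v) - 0 * p v), 0 => /=.
  + move=> _ _ x y [s /= s0 <-] [t /= t0 <-].
    exists (fun x => p (x + (s + t) *: v) - (s + t) * p v).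
      by exists (s + t) => //=; rewrite addr_ge0.
    have := pD (x + s *: v) (y + t *: v).
    by rewrite addrACA -scalerDl; lra.
  + move=> _ t x [s /= s0 <-] t0.
    exists (fun x => p (x + (t * s) *: v) - (t * s) * p v).
      by exists (t * s) => //=; rewrite mulr_ge0.
    by rewrite -scalerA -scalerDr (sublinearZ _ _ sp)//; lra.
- by move=> x; have := infF 0 x (lexx 0); rewrite scale0r addr0 mul0r subr0.
(* The member [t = 1] takes the value [p 0 - p v = - p v] at [- v]. *)
- have := infF 1 (- v) ler01.
  by rewrite scale1r addNr (sublinear0 sp) mul1r sub0r.
Qed.

(* By Zorn: chains of sublinear functionals are bounded below by their infima. *)
Lemma minimal_sublinear p : sublinear p -> exists q,
  [/\ sublinear q, forall x, q x <= p x &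
      forall q', sublinear q' -> (forall x, q' x <= q x) -> q' = q].
Proof.
move=> sp; pose T := {q : V -> R | sublinear q /\ forall x, q x <= p x}.
(* The order is reversed: Zorn's maximal elements are then minimal functionals. *)
pose below (q1 q2 : T) := `[< forall x, sval q2 x <= sval q1 x >].
have p_in : sublinear p /\ forall x, p x <= p x by [].
have [|q1 q2 q3 /asboolP q21 /asboolP q32|A totA|[q [sq qp]] qmin] :=
    @ZL_preorder T (exist _ p p_in) below.
- by move=> q; apply/asboolP.
- by apply/asboolP => x; exact: le_trans (q21 x).
- have [[q0 Aq0]|A0] := pselect (A !=set0); last first.
    by exists (exist _ p p_in) => q Aq; case: A0; exists q.
  pose F := [set sval q | q in A].
  have lbF x : has_lbound [set q x | q in F].
    (* A bound uniform over the chain: [- p (- x) <= - q (- x) <= q x]. *)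
    exists (- p (- x)) => _ [_ [[q [sq qp]] /= _ <-] <-].
    by rewrite (le_trans _ (sublinear_geN x sq))// lerN2.
  have sF : sublinear (fun x => inf [set q x | q in F]).
    apply: inf_sublinear => //.
    + by exists (sval q0), q0.
    + move=> _ _ x y [q1 Aq1 <-] [q2 Aq2 <-].
      have [/asboolP le21|/asboolP le12] := totA _ _ Aq1 Aq2.
      * exists (sval q2); first by exists q2.
        by rewrite (le_trans ((svalP q2).1.1 x y))// lerD2r.
      * exists (sval q1); first by exists q1.
        by rewrite (le_trans ((svalP q1).1.1 x y))// lerD2l.
    + move=> _ t x [q1 Aq1 <-] t0; exists (sval q1); first by exists q1.
      exact: (svalP q1).1.2.
  have infF (q : T) x : A q -> inf [set q x | q in F] <= sval q x.
    by move=> Aq; apply: (ge_inf (lbF x)); exists (sval q) => //; exists q.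
  have Fp x : inf [set q x | q in F] <= p x.
    exact: le_trans (infF _ _ Aq0) ((svalP q0).2 x).
  exists (exist (fun q => sublinear q /\ forall x, q x <= p x) _ (conj sF Fp)).
  move=> q Aq; apply/asboolP => x /=.
  exact: infF.
- exists q; split=> // q' sq' q'q.
  have q'p x : q' x <= p x by exact: le_trans (qp x).
  have /asboolP qq' := qmin (exist _ q' (conj sq' q'p)) (asboolT q'q).
  by apply/funext => x; apply/eqP; rewrite eq_le q'q; exact: qq'.
Qed.

(* A minimal sublinear functional [q] satisfies [q (- x) <= - q x] by
   [sublinear_shift], hence it is odd and therefore linear. *)
Lemma hahn_banach p v : sublinear p -> exists f : V -> R,
  [/\ linear (f : V -> R^o), forall x, f x <= p x & f v = p v].
Proof.
move=> /(sublinear_shift _ v)[p' [sp' p'p p'v]].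
have [q [sq qp' qmin]] := minimal_sublinear _ sp'.
have qN x : q (- x) = - q x.
  apply/eqP; rewrite eq_le; apply/andP; split; last first.
    by rewrite lerNl sublinear_geN.
  have [q' [sq' q'q q'x]] := sublinear_shift _ x sq.
  by rewrite -{1}(qmin q').
have qD x y : q (x + y) = q x + q y.
  apply/eqP; rewrite eq_le sq.1/=.
  by have := sq.1 (- x) (- y); rewrite -opprD !qN; lra.
exists q; split=> [a x y|x|].
- rewrite qD; congr (_ + _); have [a0|a0] := leP 0 a; first exact: sublinearZ.
  rewrite -[a]opprK scaleNr qN (sublinearZ _ _ sq) ?oppr_ge0 ?ltW//.
  by rewrite -mulNr.
- exact: le_trans (p'p x).
(* The lower bound on [q v] is [- q v = q (- v) <= p' (- v) <= - p v]. *)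
- apply/eqP; rewrite eq_le (le_trans (qp' v) (p'p v))/=.
  by have := qp' (- v); rewrite qN; lra.
Qed.

End HahnBanach.

(** Hahn-Banach with the norm as dominating functional; oddness turns [f x <= |x|] into a bound on
    the absolute value. Asking for norm at most 1 rather than equal to 1 admits [v = 0]. *)
Lemma norming_functional {R : realType} {V : normedModType R} (v : V) :
  exists2 f : dual V, `|f| <= 1 & f v = `|v|.
Proof.
have sN : sublinear (fun x : V => `|x|).
  by split=> [x y|t x t0]; rewrite ?ler_normD// normrZ ger0_norm.
have [f [lf fN fv]] := hahn_banach _ v sN.
have f_le x : `|f x| <= `|x|.
  have fNx : f (- x) = - f x.
    pose g : {linear V -> R^o} :=
      HB.pack (f : V -> R^o) (GRing.isLinear.Build R V R^o *:%R f lf).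
    exact: (linearN g).
  by rewrite ler_norml lerNl -fNx fN -normrN fN.
have bf : (f : V -> R^o) \in @bounded_linear R V R^o.
  by apply/bounded_linearP; split=> //; exists 1 => x; rewrite mul1r.
exists (BoundedOp bf) => //.
by apply: op_norm_le => x; exact: le_trans (f_le x).
Qed.

(** * Roughness and slices of functionals *)

Lemma le_limf_esup0P {R : realType} {Z : normedModType R} (f : Z -> R) (d : R) :
  (d%:E <= limf_esup (fun y => (f y)%:E) (0%R : Z)^')%E <->
  forall e r, 0 < e -> 0 < r -> exists y, [/\ y != 0, `|y| < r & d - e < f y].
Proof.
split=> [df e r e0 r0|df].
- pose A := [set y : Z | y != 0 /\ `|y| < r].
  have A0 : (0 : Z)^' A.
    by apply/nbhs_norm0P; exists r => //= y yr y0.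
  have /ereal_sup_gt[_ [y [y0 yr] <-] dy] :
      ((d - e)%:E < ereal_sup [set (f y)%:E | y in A])%E.
    apply: (@lt_le_trans _ _ d%:E); first by rewrite lte_fin ltrBlDr ltrDl.
    by rewrite (le_trans df)//; apply: ereal_inf_lbound; exists A.
  by exists y; split=> //; rewrite -lte_fin.
- apply: le_ereal_inf_tmp => _ [A /nbhs_norm0P[r /= r0 rA] <-].
  apply/lee_subgt0Pr => e e0.
  have [y [y0 yr dy]] := df e r e0 r0.
  apply: le_ereal_sup_tmp; exists (f y)%:E; last by rewrite -EFinB lee_fin ltW.
  by exists y => //; exact: rA.
Qed.

(** If every unit vector failed, the quotient would exceed [e] at arbitrarily small [u], making [W]
    [e]-rough. *)
Lemma non_rough_nearly_smooth {R : realType} {W : normedModType R} (e : R) :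
  non_rough W -> 0 < e -> exists w : W, `|w| = 1 /\
  exists2 r, 0 < r & forall u, `|u| < r ->
    `|w + u| + `|w - u| - 2 <= e * `|u|.
Proof.
move=> nW e0; apply: contrapT => nex; apply: nW; exists e => // w w1.
apply/le_limf_esup0P => e' r e'0 r0; apply: contrapT => ney.
apply: nex; exists w; split=> //; exists r => // u ur.
have [->|u0] := eqVneq u 0; first by rewrite subr0 addr0 normr0 mulr0 w1; lra.
rewrite -ler_pdivrMr ?normr_gt0// leNgt; apply/negP => eu.
by apply: ney; exists u; split=> //; rewrite (lt_trans _ eu)// ltrBlDr ltrDl.
Qed.

(** Bare functions are used so that evaluations at points of the unit ball of X count as functionals
    on its dual, without passing through the bidual. *)
Definition contractive_functional {R : realType} {W : normedModType R}
  (g : W -> R) := linear (g : W -> R^o) /\ forall u, `|g u| <= `|u|.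

Section ContractiveFunctional.
Context {R : realType} {W : normedModType R} {g : W -> R}.
Hypothesis cg : contractive_functional g.

Lemma contractive_functionalD u v : g (u + v) = g u + g v.
Proof. by have := cg.1 1 u v; rewrite !scale1r. Qed.

Lemma contractive_functionalZ a u : g (a *: u) = a * g u.
Proof.
have g0 : g 0 = 0.
  by apply/eqP; rewrite -normr_le0 (le_trans (cg.2 0))// normr0.
by have := cg.1 a u 0; rewrite !addr0 g0 addr0.
Qed.

Lemma contractive_functional_le u : g u <= `|u|.
Proof. exact: le_trans (ler_norm _) (cg.2 u). Qed.

End ContractiveFunctional.

(** Smulyan's argument: [g1] is tested on [w + c u] and [g2] on [w - c u]; in the sum, near
    smoothness at [w] bounds [c (g1 u - g2 u)]. *)
Lemma non_rough_small_slice {R : realType} {W : normedModType R} (e : R) :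
  non_rough W -> 0 < e -> exists w : W, `|w| = 1 /\
  exists2 a, 0 < a < 1 & forall g1 g2 : W -> R,
    contractive_functional g1 -> contractive_functional g2 ->
    1 - a <= g1 w -> 1 - a <= g2 w -> forall u, g1 u <= g2 u + e * `|u|.
Proof.
move=> nW e0; have e2 : 0 < e / 2 by rewrite divr_gt0.
have [w [w1 [r r0 wr]]] := non_rough_nearly_smooth _ nW e2.
exists w; split=> //.
pose t := r / 2.
have t0 : 0 < t by rewrite divr_gt0.
have a0 : 0 < e * t / 4 by rewrite divr_gt0// mulr_gt0.
(* The defects of [g1 w] and [g2 w] from 1 cost at most [2 a <= e t / 2], and near smoothness with
   constant [e / 2] costs as much again. The cap [1 / 2] ensures [a < 1]. *)
exists (Num.min (e * t / 4) 2^-1).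
  by rewrite lt_min a0 invr_gt0 ltr0n/= gt_min; apply/orP; right; lra.
set a := Num.min _ _ => g1 g2 cg1 cg2 g1w g2w u.
have aet : a <= e * t / 4 by rewrite ge_min lexx.
have [->|u0] := eqVneq u 0.
  by rewrite normr0 mulr0 addr0 -[0](scale0r 0) (contractive_functionalZ cg1)
    (contractive_functionalZ cg2) !mul0r.
have nu0 : 0 < `|u| by rewrite normr_gt0.
pose c := t / `|u|.
have c0 : 0 < c by rewrite divr_gt0.
have cu : `|c *: u| = t by rewrite normrZ gtr0_norm// divfK ?gt_eqF.
have := wr (c *: u); rewrite cu => /(_ _).
have -> : t < r by rewrite /t; lra.
move=> /(_ isT) wcu.
have := contractive_functional_le cg1 (w + c *: u).
have := contractive_functional_le cg2 (w - c *: u).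
rewrite !(contractive_functionalD cg1, contractive_functionalD cg2).
rewrite -scaleNr !(contractive_functionalZ cg1, contractive_functionalZ cg2).
rewrite scaleNr mulNr => h2 h1.
have : c * (g1 u - g2 u) <= c * (e * `|u|).
  rewrite [leRHS]mulrCA divfK ?gt_eqF//; lra.
by rewrite ler_pM2l//; lra.
Qed.

(** * Transfer of roughness through an abstract pairing *)

Lemma average_quotient_sum {R : realType} {V : normedModType R}
    n (z : 'I_n -> V) y :
  n%:R^-1 * (\sum_(i < n) rough_quotient (z i) y) =
  n%:R^-1 * (\sum_(i < n) (`|z i + y| + `|z i - y| - 2)) / `|y|.
Proof. by rewrite /rough_quotient -mulr_suml mulrA. Qed.

(* The functionals [T |-> h j (phi i T) = g i (psi j T)] on the operator space E
   play the role of [T |-> f (T x)] for [x] and [f] in the unit balls of X and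
   of the dual of Y; since W and Z are interchangeable here, both the case
   W = X^*, Z = Y and the case W = Y, Z = X^* are covered. *)
Section TensorPairing.
Context {R : realType} {E W Z : normedModType R} {I J : Type}.
Context {g : I -> W -> R} {h : J -> Z -> R}.
Context {phi : I -> E -> Z} {psi : J -> E -> W} {tensor : W -> Z -> E}.
Hypothesis g_contr : forall i, contractive_functional (g i).
Hypothesis h_contr : forall j, contractive_functional (h j).
Hypothesis phi_linear : forall i, linear (phi i).
Hypothesis phi_contr : forall i T, `|phi i T| <= `|T|.
Hypothesis psi_contr : forall j T, `|psi j T| <= `|T|.
Hypothesis pairing : forall i j T, h j (phi i T) = g i (psi j T).
Hypothesis pairing_tensor :
  forall i j w z, h j (phi i (tensor w z)) = g i w * h j z.
Hypothesis norm_tensor :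
  forall w z, `|w| = 1 -> `|z| = 1 -> `|tensor w z| = 1.
Hypothesis g_norming :
  forall w a, `|w| = 1 -> 0 < a -> exists i, 1 - a <= g i w.
Hypothesis pairing_norming : forall w z T s, 0 < s ->
  exists i j, `|T| - s < h j (phi i T) /\ (0 <= g i w \/ 0 <= h j z).

Let phiD i S T : phi i (S + T) = phi i S + phi i T.
Proof. by have := phi_linear i 1 S T; rewrite !scale1r. Qed.

Let phi0 i : phi i 0 = 0.
Proof. by apply/eqP; rewrite -normr_le0 (le_trans (phi_contr i 0))// normr0. Qed.

Let phiN i T : phi i (- T) = - phi i T.
Proof. by have := phi_linear i (-1) T 0; rewrite !addr0 phi0 addr0 !scaleN1r. Qed.

Lemma norm_tensorD_le (e : R) : non_rough W -> 0 < e -> exists w i,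
  `|w| = 1 /\ exists2 r, 0 < r & forall z T, `|z| = 1 -> `|T| < r ->
    `|tensor w z + T| <= `|z + phi i T| + e * `|T|.
Proof.
move=> nW e0.
have [w [w1 [a /andP[a0 a1] slice]]] := non_rough_small_slice _ nW e0.
have [i0 gi0] := g_norming _ _ w1 a0.
(* Three losses of at most [a / 4] each occur below: in the norm of the perturbed tensor, in the
   choice of [i] and [j], and in [h j (phi i T)]. The product [g i w * h j z] thus stays above
   [1 - a]. *)
exists w, i0; split=> //; exists (a / 4); first by rewrite divr_gt0.
move=> z T z1 Ta; apply/ler_addgt0Pr => s s0.
have m0 : 0 < Num.min s (a / 4) by rewrite lt_min s0 divr_gt0.
set m := Num.min _ _ in m0.
have ms : m <= s by rewrite ge_min lexx.
have ma : m <= a / 4 by rewrite ge_min lexx orbT.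
have [i [j [nT sgn]]] := pairing_norming w z (tensor w z + T) _ m0.
move: nT; rewrite phiD (contractive_functionalD (h_contr j)) pairing_tensor => nT.
have big : 1 - a / 4 <= `|tensor w z + T|.
  have := ler_normB (tensor w z + T) T; rewrite addrK norm_tensor//; lra.
have hT : h j (phi i T) <= a / 4.
  rewrite (le_trans (contractive_functional_le (h_contr j) _))//.
  by rewrite (le_trans (phi_contr i T))// ltW.
have prod : 1 - a < g i w * h j z by lra.
have gw1 : g i w <= 1 by rewrite -w1 contractive_functional_le.
have hz1 : h j z <= 1 by rewrite -z1 contractive_functional_le.
(* As [a < 1] the product is positive; [sgn] excludes two negative factors, and both being at most
   1, each exceeds [1 - a]. *)
have prod0 : 0 < g i w * h j z by lra.
have gw0 : 0 < g i w.
  case: sgn => [gw|hz].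
    rewrite lt_neqAle gw andbT eq_sym; apply/negP => /eqP gw0.
    by move: prod0; rewrite gw0 mul0r ltxx.
  rewrite ltNge; apply/negP => gw.
  by have := mulr_le0_ge0 gw hz; lra.
have hz0 : 0 < h j z by rewrite -(pmulr_rgt0 _ gw0).
have gwa : 1 - a <= g i w.
  by rewrite (le_trans (ltW prod))// ler_piMr// ltW.
(* Both [g i] and [g i0] lie in the slice, so on [psi j T] the index [i] may be exchanged for [i0];
   [pairing] carries this over to [h j (phi i T)]. *)
have := slice _ _ (g_contr i) (g_contr i0) gwa gi0 (psi j T).
rewrite -!pairing => hphi.
have : e * `|psi j T| <= e * `|T| by rewrite ler_pM2l.
have : g i w * h j z <= h j z by rewrite ler_piMl// ltW.
have := contractive_functional_le (h_contr j) (z + phi i0 T).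
rewrite (contractive_functionalD (h_contr j)); lra.
Qed.

(** Fixing [n] and [z] lets the same lemma give average roughness and, with [n = 1], roughness. *)
Lemma average_rough_transfer (delta : R) n (z : 'I_n -> Z) :
  non_rough W -> 0 < delta -> (0 < n)%N -> (forall i, `|z i| = 1) ->
  (forall w, `|w| = 1 -> (delta%:E <= limf_esup (fun T =>
    (n%:R^-1 * \sum_(i < n) rough_quotient (tensor w (z i)) T)%:E)
      (0%R : E)^')%E) ->
  (delta%:E <= limf_esup (fun y =>
    (n%:R^-1 * \sum_(i < n) rough_quotient (z i) y)%:E) (0%R : Z)^')%E.
Proof.
move=> nW d0 n0 z1 rE; apply/le_limf_esup0P => e0 r0 e00 r00.
have mm0 : 0 < Num.min e0 delta by rewrite lt_min e00.
(* One [e] is lost in approximating the limit superior and two in comparing norms at [T] and [- T];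
   [delta - 3 * e] must remain positive and above [delta - e0]. *)
pose e := Num.min e0 delta / 4.
have e_gt0 : 0 < e by rewrite divr_gt0.
have ee0 : 4 * e <= e0 by rewrite /e mulrC divfK// ge_min lexx.
have ed : 4 * e <= delta by rewrite /e mulrC divfK// ge_min lexx orbT.
have [w [i [w1 [r r_gt0 wi]]]] := norm_tensorD_le _ nW e_gt0.
have mr0 : 0 < Num.min r r0 by rewrite lt_min r_gt0.
have /le_limf_esup0P/(_ _ _ e_gt0 mr0)[T [T0]] := rE w w1.
rewrite lt_min => /andP[Tr Tr0] dT.
have nT0 : 0 < `|T| by rewrite normr_gt0.
pose A := n%:R^-1 * \sum_(k < n) (`|z k + phi i T| + `|z k - phi i T| - 2).
have n0R : 0 < n%:R :> R by rewrite ltr0n.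
have AT : n%:R^-1 * (\sum_(k < n)
    (`|tensor w (z k) + T| + `|tensor w (z k) - T| - 2)) <= A + 2 * e * `|T|.
  rewrite /A ler_pdivrMl// mulrDr mulVKf ?gt_eqF//.
  have -> : n%:R * (2 * e * `|T|) = \sum_(k < n) 2 * e * `|T|.
    by rewrite sumr_const card_ord mulr_natl.
  rewrite -big_split/=.
  apply: ler_sum => k _.
  have := wi (z k) T (z1 k) Tr.
  have := wi (z k) (- T) (z1 k); rewrite normrN phiN => /(_ Tr); lra.
move: dT; rewrite average_quotient_sum ltr_pdivlMr// => dT.
have AT' : (delta - 3 * e) * `|T| < A by lra.
have d3 : 0 < delta - 3 * e by lra.
have A0 : 0 < A by rewrite (lt_trans _ AT')// mulr_gt0.
(* The witness must be nonzero: if [phi i T = 0], every summand of [A] is [1 + 1 - 2 = 0]. *)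
have phiT0 : phi i T != 0.
  apply: contraTneq A0 => pT; rewrite /A pT big1 ?mulr0 ?ltxx// => k _.
  by rewrite addr0 subr0 z1; lra.
exists (phi i T); split=> //; first exact: le_lt_trans (phi_contr i T) Tr0.
rewrite average_quotient_sum -/A ltr_pdivlMr ?normr_gt0//.
apply: le_lt_trans AT'.
(* Since [phi i] is contractive, passing from [T] to [phi i T] only shrinks the denominator. *)
rewrite (@le_trans _ _ ((delta - 3 * e) * `|phi i T|))//.
  by rewrite ler_wpM2r//; lra.
by rewrite ler_pM2l.
Qed.

Lemma rough_pairing (delta : R) : non_rough W -> 0 < delta ->
  (average_rough E delta -> average_rough Z delta) /\
  (rough E delta -> rough Z delta).
Proof.
move=> nW d0; split=> [aE n z n0 z1|rE z z1].
  apply: average_rough_transfer => // w w1.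
  by apply: aE => // i; exact: norm_tensor.
have avg1 (V : normedModType R) (v : V) : (fun y => (rough_quotient v y)%:E) =
    (fun y => (1%:R^-1 * \sum_(i < 1) rough_quotient v y)%:E).
  by apply/funext => y; rewrite big_ord1 invr1 mul1r.
rewrite avg1; apply: (@average_rough_transfer delta 1 (fun=> z)) => // w w1.
by rewrite -avg1; apply: rE; exact: norm_tensor.
Qed.

End TensorPairing.

(** * Rank-one operators, compositions and norming vectors *)

Section BoundedOperators.
Context {R : realType}.
Implicit Types X Y : normedModType R.

Lemma ler_op_norm {X Y} (T : 'L(X, Y)) (x : X) : `|T x| <= `|T| * `|x|.
Proof.
have [->|x0] := eqVneq x 0; first by rewrite linear0 !normr0 mulr0.
have nx0 : 0 < `|x| by rewrite normr_gt0.
rewrite -ler_pdivrMr// mulrC -(gtr0_norm nx0) -normfV -normrZ -linearZ.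
by apply: ler_op_norm1; rewrite normrZ normfV normr_id mulVf ?gt_eqF.
Qed.

Lemma contractive_functional_dual {X} (f : dual X) :
  `|f| <= 1 -> contractive_functional f.
Proof.
move=> f1; split; first exact: bounded_op_linear.
by move=> u; rewrite (le_trans (ler_op_norm f u))// ler_piMl.
Qed.

Lemma contractive_functional_eval {X} (x : X) :
  `|x| <= 1 -> contractive_functional (fun f : dual X => f x).
Proof. by move=> x1; split=> // f; exact: ler_op_norm1. Qed.

Lemma tensor_subproof {X Y} (f : dual X) (y : Y) :
  (fun x => (f x : R) *: y) \in @bounded_linear R X Y.
Proof.
apply/bounded_linearP; split=> [a u v|].
  by rewrite linearP scalerDl scalerA.
exists (`|f| * `|y|) => x.
by rewrite normrZ mulrAC ler_wpM2r//; exact: ler_op_norm.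
Qed.

Definition tensor {X Y} (f : dual X) (y : Y) : 'L(X, Y) :=
  BoundedOp (tensor_subproof f y).

(** The range has to equal the span, so a zero functional takes the empty family and any other takes
    [y] alone. *)
Lemma finite_rank_tensor {X Y} (f : dual X) (y : Y) : finite_rank (tensor f y).
Proof.
have [f0|/existsNP[x /eqP fx0]] := pselect (forall x, f x = 0).
  exists 0, (fun=> 0); apply/seteqP; split=> [_ [x _ <-]|_ [c _ <-]].
    by exists (fun=> 0) => //; rewrite big_ord0 /= f0 scale0r.
  by exists 0 => //; rewrite big_ord0 /= f0 scale0r.
exists 1, (fun=> y); apply/seteqP; split=> [_ [u _ <-]|_ [c _ <-]].
  by exists (fun=> f u) => //; rewrite big_ord1.
exists ((c ord0 / f x) *: x) => //.
by rewrite big_ord1 /= linearZ; congr (_ *: y); exact: divfK.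
Qed.

Lemma norm_tensor1 {X Y} (f : dual X) (y : Y) :
  `|f| = 1 -> `|y| = 1 -> `|tensor f y| = 1.
Proof.
move=> f1 y1.
have tfy x : `|tensor f y x| = `|f x| by rewrite /= normrZ y1 mulr1.
apply/eqP; rewrite eq_le -{2}f1; apply/andP; split.
  by apply: op_norm_le => x x1; rewrite tfy -f1 ler_op_norm1.
by apply: op_norm_le => x x1; rewrite -tfy ler_op_norm1.
Qed.

Lemma comp_op_subproof {X Y} (f : dual Y) (T : 'L(X, Y)) :
  (fun x => f (T x)) \in @bounded_linear R X R^o.
Proof.
apply/bounded_linearP; split=> [a u v|]; first by rewrite !linearP.
exists (`|f| * `|T|) => x.
by rewrite (le_trans (ler_op_norm _ _))// -mulrA ler_wpM2l// ler_op_norm.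
Qed.

Definition comp_op {X Y} (f : dual Y) (T : 'L(X, Y)) : dual X :=
  BoundedOp (comp_op_subproof f T).

Lemma norm_comp_op {X Y} (f : dual Y) (T : 'L(X, Y)) :
  `|f| <= 1 -> `|comp_op f T| <= `|T|.
Proof.
move=> f1; apply: op_norm_le => x x1.
by rewrite (le_trans ((contractive_functional_dual _ f1).2 _))// ler_op_norm1.
Qed.

Lemma op_norm_adherent {X Y} (T : 'L(X, Y)) (s : R) : 0 < s ->
  exists2 x : X, `|x| <= 1 & `|T| - s < `|T x|.
Proof.
move=> s0; have [_ [x x1 <-] Tx] := sup_adherent s0 (op_norm_has_sup T).
by exists x.
Qed.

Lemma exists_opp_ge0 {X} (f : dual X) (x : X) : exists2 x' : X,
  x' = x \/ x' = - x & 0 <= f x'.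
Proof.
have [fx|fx] := leP 0 (f x); first by exists x => //; left.
by exists (- x); [right|rewrite linearN oppr_ge0 ltW].
Qed.

(** Replacing [x] by [- x] keeps the norm of [T x], so the sign of [u x] can be fixed first; [f] is
    then chosen to norm [T x']. *)
Lemma op_norming_pair {X Y} (u : dual X) (T : 'L(X, Y)) (s : R) : 0 < s ->
  exists (x : X) (f : dual Y),
    [/\ `|x| <= 1, `|f| <= 1, 0 <= u x & `|T| - s < f (T x)].
Proof.
move=> /(op_norm_adherent T)[x x1 Tx].
have [x' xx' ux'] := exists_opp_ge0 u x.
have [f f1 fT] := norming_functional (T x').
exists x', f; split=> //; first by case: xx' => ->; rewrite ?normrN.
by rewrite fT; case: xx' => ->; rewrite ?linearN ?normrN.
Qed.

Lemma dual_norming_vector {X} (u : dual X) (s : R) : 0 < s ->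
  exists2 x : X, `|x| <= 1 & `|u| - s <= u x.
Proof.
move=> /(op_norm_adherent u)[x x1 ux].
have [x' xx' ux'] := exists_opp_ge0 u x.
exists x'; first by case: xx' => ->; rewrite ?normrN.
rewrite -[leRHS](ger0_norm ux') ltW//.
by case: xx' => ->; rewrite ?linearN ?normrN.
Qed.

End BoundedOperators.

(** * The two instances of the pairing on the operator subspace *)

Section OperatorSubspace.
Context {R : realType} {X Y : normedModType R} (H : submodClosed 'L(X, Y)).
Hypothesis H_finite_rank : forall f : 'L(X, Y), finite_rank f -> f \in H.

Let ballX := {x : X | `|x| <= 1}.
Let ballY' := {f : dual Y | `|f| <= 1}.

Let tensorH (f : dual X) (y : Y) : subspace_of H :=
  SubspaceOf (H_finite_rank _ (finite_rank_tensor f y)).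

Let ev_at (x : ballX) (T : subspace_of H) : Y := subspace_val T (sval x).

Let adj_at (f : ballY') (T : subspace_of H) : dual X :=
  comp_op (sval f) (subspace_val T).

Let ev_at_linear x : linear (ev_at x). Proof. by []. Qed.

Let adj_at_linear f : linear (adj_at f).
Proof. by move=> a S T; apply/val_inj/funext => x /=; exact: linearP. Qed.

Let ev_at_contr x T : `|ev_at x T| <= `|T|.
Proof. by apply: ler_op_norm1; exact: svalP x. Qed.

Let adj_at_contr f T : `|adj_at f T| <= `|T|.
Proof. by apply: norm_comp_op; exact: svalP f. Qed.

(** Here W is the dual of X and Z is Y: the transfer map is evaluation at a point, and the sign
    condition holds on the W side. *)
Lemma rough_codomain (delta : R) : non_rough (dual X) -> 0 < delta ->
  (average_rough (subspace_of H) delta -> average_rough Y delta) /\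
  (rough (subspace_of H) delta -> rough Y delta).
Proof.
pose ev_dual (x : ballX) (f : dual X) : R := f (sval x).
pose app_dual (f : ballY') (y : Y) : R := sval f y.
have ev_contr x : contractive_functional (ev_dual x).
  exact: contractive_functional_eval (svalP x).
have app_contr f : contractive_functional (app_dual f).
  exact: contractive_functional_dual (svalP f).
have pairing x f T : app_dual f (ev_at x T) = ev_dual x (adj_at f T) by [].
have pairing_tensor x f w z :
    app_dual f (ev_at x (tensorH w z)) = ev_dual x w * app_dual f z.
  exact: linearZ.
have norm_tensor w z : `|w| = 1 -> `|z| = 1 -> `|tensorH w z| = 1.
  exact: norm_tensor1.
have ev_norming w a : `|w| = 1 -> 0 < a -> exists x, 1 - a <= ev_dual x w.
  move=> <- /(dual_norming_vector w)[x x1 wx].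
  by exists (exist _ x x1).
have norming w z T s : 0 < s -> exists x f,
    `|T| - s < app_dual f (ev_at x T) /\ (0 <= ev_dual x w \/ 0 <= app_dual f z).
  move=> /(op_norming_pair w (subspace_val T))[x [f [x1 f1 wx Tx]]].
  by exists (exist _ x x1), (exist _ f f1); split=> //; left.
exact: (rough_pairing ev_contr app_contr ev_at_linear ev_at_contr
  adj_at_contr pairing pairing_tensor norm_tensor ev_norming norming).
Qed.

(** The roles are swapped: the transfer map sends [T] to its adjoint applied to a fixed functional.
    The same norming pair serves, its sign condition now falling on the Z side. *)
Lemma rough_dual_domain (delta : R) : non_rough Y -> 0 < delta ->
  (average_rough (subspace_of H) delta -> average_rough (dual X) delta) /\
  (rough (subspace_of H) delta -> rough (dual X) delta).
Proof.
pose ev_dual (x : ballX) (f : dual X) : R := f (sval x).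
pose app_dual (f : ballY') (y : Y) : R := sval f y.
have ev_contr x : contractive_functional (ev_dual x).
  exact: contractive_functional_eval (svalP x).
have app_contr f : contractive_functional (app_dual f).
  exact: contractive_functional_dual (svalP f).
have pairing f x T : ev_dual x (adj_at f T) = app_dual f (ev_at x T) by [].
have pairing_tensor f x w z :
    ev_dual x (adj_at f (tensorH z w)) = app_dual f w * ev_dual x z.
  by rewrite mulrC; exact: linearZ.
have norm_tensor w z : `|w| = 1 -> `|z| = 1 -> `|tensorH z w| = 1.
  by move=> w1 z1; exact: norm_tensor1.
have app_norming w a : `|w| = 1 -> 0 < a -> exists f, 1 - a <= app_dual f w.
  move=> w1 a0; have [f f1 fw] := norming_functional w.
  by exists (exist _ f f1); rewrite /app_dual /= fw w1 lerBlDr lerDl ltW.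
have norming (w : Y) z T s : 0 < s -> exists f x,
    `|T| - s < ev_dual x (adj_at f T) /\ (0 <= app_dual f w \/ 0 <= ev_dual x z).
  move=> /(op_norming_pair z (subspace_val T))[x [f [x1 f1 wx Tx]]].
  by exists (exist _ f f1), (exist _ x x1); split=> //; right.
exact: (rough_pairing app_contr ev_contr adj_at_linear adj_at_contr
  ev_at_contr pairing pairing_tensor norm_tensor app_norming norming).
Qed.

End OperatorSubspace.

Theorem theorem3p1 (R : realType) (X Y : completeNormedModType R)
    (X_nontrivial : exists x : X, x != 0) (Y_nontrivial : exists y : Y, y != 0)
    (H : submodClosed 'L(X, Y)) (H_closed : closed [set` H])
    (H_finite_rank : forall f : 'L(X, Y), finite_rank f -> f \in H)
    (delta : R) (delta_gt0 : 0 < delta) :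
  (average_rough (subspace_of H) delta ->
    (non_rough (dual X) -> average_rough Y delta) /\
    (non_rough Y -> average_rough (dual X) delta)) /\
  (rough (subspace_of H) delta ->
    (non_rough (dual X) -> rough Y delta) /\
    (non_rough Y -> rough (dual X) delta)).
Proof.
split=> rH; split=> nR.
- exact: (rough_codomain H H_finite_rank delta nR delta_gt0).1.
- exact: (rough_dual_domain H H_finite_rank delta nR delta_gt0).1.
- exact: (rough_codomain H H_finite_rank delta nR delta_gt0).2.
- exact: (rough_dual_domain H H_finite_rank delta nR delta_gt0).2.
Qed.
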